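(* Fix $\alpha,\beta\in[0,1)$ with $\alpha+\beta<1$. For each $n$ let $k=k_n$, $l=l_n$ be integers with $\liminf_{n\to\infty} l_n/n>\beta$ and $\limsup_{n\to\infty}(k_n+l_n)/n<1-\alpha$, i.e. the code rates $R_0=l/n$, $R_1=k/n$ eventually satisfy $R_0>\beta$ and $R_0+R_1<1-\alpha$ with margins bounded away from $0$. Let $\widetilde G=[G_1\ G_0]$ be an $n\times(k+l)$ binary matrix with i.i.d. uniform entries ($G_1$ its first $k$ columns, $G_0$ its last $l$ columns), and let $\mathbf m\in\{0,1\}^k$ be arbitrary. Then, for the binary defect and erasure channel with the encoding and decoding described in the context, the probability of recovery failure $P(\widehat{\mathbf m}\neq\mathbf m)$ tends to $0$ as $n\to\infty$.
   Context: All arithmetic is over $\mathrm{GF}(2)$. Binary defect and erasure channel (BDEC) with parameters $(\beta,\alpha)$: each of the $n$ cells is independently defective with probability $\beta$; a defective cell is stuck at $0$ or $1$, each with probability $1/2$, independently. Writing codeword $\mathbf c$ stores $\mathbf c\circ\mathbf s$, where $(\mathbf c\circ\mathbf s)_i=s_i$ if cell $i$ is defective with stuck-at value $s_i$ and $=c_i$ otherwise. Then each of the $n$ stored bits is independently erased with probability $\alpha$ (independently of everything else); $\mathcal V$ is the set of unerased positions and the decoder observes $\mathcal V$ and $\mathbf y^{\mathcal V}=(\mathbf c\circ\mathbf s)^{\mathcal V}$. For a matrix/vector, superscript $\mathcal A$ denotes the rows indexed by the set $\mathcal A$. Encoding: with $\mathcal U$ the set of defects and $\mathbf b^{\mathcal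 U}=(G_1\mathbf m)^{\mathcal U}+\mathbf s^{\mathcal U}$, find $\mathbf d\in\{0,1\}^l$ with $G_0^{\mathcal U}\mathbf d=\mathbf b^{\mathcal U}$ and write $\mathbf c=G_1\mathbf m+G_0\mathbf d$; encoding failure ($E=0$) if no such $\mathbf d$ exists. Decoding: solve $\widetilde G^{\mathcal V}\binom{\widehat{\mathbf m}}{\widehat{\mathbf d}}=\mathbf y^{\mathcal V}$. The event $\{\widehat{\mathbf m}\neq\mathbf m\}$ (recovery failure) is declared if encoding fails, or if the solution set of this linear system contains vectors with different message parts $\widehat{\mathbf m}$, or does not contain $(\mathbf m,\mathbf d)$. *)

(* Defs.v *)
From HB Require Import structures.
From mathcomp Require Import all_boot all_order all_algebra.
Set Implicit Arguments. Unset Strict Implicit. Unset Printing Implicit Defensive.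
Import Order.TTheory GRing.Theory Num.Theory.
Local Open Scope ring_scope.

Definition encode_d (n k l : nat) (G : 'M['F_2]_(n, k + l)) (U : {set 'I_n})
  (s : 'cV['F_2]_n) (m : 'cV['F_2]_k) : option 'cV['F_2]_l :=
  [pick d : 'cV['F_2]_l |
     [forall i in U, (rsubmx G *m d) i 0 == (lsubmx G *m m + s) i 0]].

Definition recovery_failure (n k l : nat) (G : 'M['F_2]_(n, k + l))
  (U : {set 'I_n}) (s : 'cV['F_2]_n) (V : {set 'I_n}) (m : 'cV['F_2]_k) : bool :=
  match encode_d G U s m with
  | None => true
  | Some d =>
      let c := lsubmx G *m m + rsubmx G *m d in
      let y := \col_i (if i \in U then s i 0 else c i 0) in
      let sol (x : 'cV['F_2]_(k + l)) := [forall i in V, (G *m x) i 0 == y i 0] in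
      [exists x1 : 'cV['F_2]_(k + l), exists x2 : 'cV['F_2]_(k + l),
         [&& sol x1, sol x2 & usubmx x1 != usubmx x2]]
      || ~~ sol (col_mx m d)
  end.

(* P(m_hat <> m): G uniform, U = defect set (each cell independently w.p. beta),
   s uniform stuck-at values (only coordinates in U matter), V = unerased set
   (each cell independently unerased w.p. 1 - alpha). *)
Definition fail_prob (R : numFieldType) (alpha beta : R) (n k l : nat)
  (m : 'cV['F_2]_k) : R :=
  \sum_(G : 'M['F_2]_(n, k + l)) \sum_(U : {set 'I_n})
  \sum_(s : 'cV['F_2]_n) \sum_(V : {set 'I_n})
    ((2%:R)^-1 ^+ (n * (k + l)) * (beta ^+ #|U| * (1 - beta) ^+ (n - #|U|))
     * (2%:R)^-1 ^+ n * ((1 - alpha) ^+ #|V| * alpha ^+ (n - #|V|)))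
    * (recovery_failure G U s V m)%:R.
Arguments fail_prob {R} alpha beta n k l m.

(* Main.v *)
(* If encoding fails, then the defect rows of G_0 are linearly dependent; if
   decoding is ambiguous, then so are the columns of the unerased rows of G.
   Both are instances of one event: a uniformly random a x b matrix over GF(q)
   has dependent rows with probability at most q^(a - b), by a union bound over
   the nonzero vectors u, since u M is then uniform on GF(q)^b.  Here a - b is
   |U| - l, respectively |W| - (n - k - l) with W the set of erasures, and both
   |U| and |W| are binomial with mean at least n delta below the threshold.
   As min(1, q^j) <= x^j for all integers j and all 1 <= x <= q, the average of
   this probability obeys Chernoff's bound; AM-GM turns the latter into a bound
   that is rational in n and tends to 0. *)
Require Import Defs.
From HB Require Import structures.
From mathcomp Require Import all_boot all_order all_algebra.
From mathcomp Require Import ring lra.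
Set Implicit Arguments.
Unset Strict Implicit.
Unset Printing Implicit Defensive.
Import Order.TTheory GRing.Theory Num.Theory.
Local Open Scope ring_scope.

Definition mean {R : pzRingType} {T : finType} (mu f : T -> R) : R :=
  \sum_t mu t * f t.

Definition prob {R : pzRingType} {T : finType} (mu : T -> R) (P : pred T) : R :=
  mean mu (fun t => (P t)%:R).

Definition distribution {R : numDomainType} {T : finType} (mu : T -> R) : Prop :=
  (forall t, 0 <= mu t) /\ \sum_t mu t = 1.

Section Mean.
Variables (R : pzRingType) (T : finType).
Implicit Types mu f g : T -> R.

Lemma eq_mean mu f g : f =1 g -> mean mu f = mean mu g.
Proof. by move=> eq_fg; apply: eq_bigr => t _; rewrite eq_fg. Qed.

Lemma meanD mu f g : mean mu (fun t => f t + g t) = mean mu f + mean mu g.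
Proof. by rewrite -big_split; apply: eq_bigr => t _; rewrite mulrDr. Qed.

Lemma mean_mulr c mu f : mean mu (fun t => f t * c) = mean mu f * c.
Proof. by rewrite /mean mulr_suml; apply: eq_bigr => t _; rewrite mulrA. Qed.

End Mean.

Lemma exchange_mean (R : comPzRingType) (T S : finType) (mu : T -> R)
    (nu : S -> R) (f : T -> S -> R) :
  mean mu (fun t => mean nu (f t)) = mean nu (fun s => mean mu (f^~ s)).
Proof.
rewrite /mean; under eq_bigr do rewrite mulr_sumr.
rewrite exchange_big; apply: eq_bigr => s _.
by rewrite mulr_sumr; apply: eq_bigr => t _; rewrite mulrCA.
Qed.

Section Distribution.
Variables (R : numDomainType) (T : finType) (mu : T -> R).
Hypothesis mu_distr : distribution mu.

Lemma mean_cst c : mean mu (fun=> c) = c.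
Proof. by rewrite /mean -mulr_suml mu_distr.2 mul1r. Qed.

Lemma ler_mean f g : (forall t, f t <= g t) -> mean mu f <= mean mu g.
Proof. by move=> le_fg; apply: ler_sum => t _; rewrite ler_wpM2l // mu_distr.1. Qed.

Lemma prob_ge0 P : 0 <= prob mu P.
Proof. by rewrite -[leLHS]mean_cst; apply: ler_mean => t; rewrite ler0n. Qed.

Lemma prob_le1 P : prob mu P <= 1.
Proof. by rewrite -[leRHS]mean_cst; apply: ler_mean => t; rewrite lern1 leq_b1. Qed.

Lemma prob_exists_le (I : finType) (Q : pred I) (P : I -> pred T) :
  prob mu (fun t => [exists (i | Q i), P i t]) <= \sum_(i | Q i) prob mu (P i).
Proof.
rewrite exchange_big /=; apply: ler_sum => t _.
rewrite -mulr_sumr ler_wpM2l ?mu_distr.1 //.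
have [/exists_inP[i Qi Pit]|_] := boolP [exists (i | Q i), P i t].
  by rewrite (bigD1 i Qi) Pit lerDl sumr_ge0.
by rewrite sumr_ge0.
Qed.

End Distribution.

Definition uniform {R : unitRingType} {T : finType} : T -> R := fun=> #|T|%:R^-1.

Lemma uniform_distribution (R : numFieldType) (T : finType) (x : T) :
  distribution (@uniform R T).
Proof.
split=> [t|]; first by rewrite invr_ge0.
rewrite sumr_const -[LHS]mulr_natr mulVf // pnatr_eq0 -lt0n.
by apply/card_gt0P; exists x.
Qed.

(* Averaging [g (f (a + h b))] over [a] gives the left-hand side for every [b],
   and averaging it over [b] gives the right-hand side for every [a]. *)
Lemma mean_uniform_additive (R : numFieldType) (A B : finZmodType)
    (f : {additive A -> B}) (h : B -> A) (g : B -> R) :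
  cancel h f -> mean uniform (g \o f) = mean uniform g.
Proof.
move=> hK.
have unifA := uniform_distribution R (0 : A).
have unifB := uniform_distribution R (0 : B).
rewrite -[LHS](mean_cst unifB) -[RHS](mean_cst unifA).
transitivity (mean uniform (fun b => mean uniform (fun a => g (f (a + h b))))).
  apply: eq_mean => b; rewrite /mean [RHS](reindex_inj (addIr (- h b))) /=.
  by under [RHS]eq_bigr do rewrite subrK.
rewrite exchange_mean; apply: eq_mean => a.
rewrite /mean [RHS](reindex_inj (addrI (f a))) /=.
by apply: eq_bigr => b _; rewrite raddfD /= hK.
Qed.

Section RandomMatrix.
Variables (R : numFieldType) (F : finFieldType).

Definition row_dependence_prob (m n : nat) : R :=
  prob uniform (fun M : 'M[F]_(m, n) => ~~ row_free M).

Lemma row_dependenceP (m n : nat) (M : 'M[F]_(m, n)) :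
  reflect (exists2 u : 'rV_m, u != 0 & u *m M = 0) (~~ row_free M).
Proof.
rewrite -kermx_eq0; apply: (iffP rowV0Pn) => -[u].
  by move=> /sub_kermxP uM0 u0; exists u.
by move=> u0 /sub_kermxP uM0; exists u.
Qed.

Lemma prob_mulmx_eq0 (m n : nat) (u : 'rV[F]_m) :
  u != 0 -> prob uniform (fun M : 'M[F]_(m, n) => u *m M == 0) = #|F|%:R ^- n :> R.
Proof.
move=> u0.
have /row_freeP[v uv] : row_free u by rewrite /row_free rank_rV u0.
have mulvK : cancel (mulmx v) (mulmx u : {additive 'M[F]_(m, n) -> 'rV_n}).
  by move=> r; rewrite /= mulmxA uv mul1mx.
rewrite /prob (mean_uniform_additive (fun r => (r == 0)%:R : R) mulvK).
rewrite /mean (bigD1 0) //= eqxx mulr1 big1 ?addr0; last first.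
  by move=> r /negPf->; exact: mulr0.
by rewrite /uniform card_mx mul1n natrX.
Qed.

Lemma row_dependence_prob01 (m n : nat) : 0 <= row_dependence_prob m n <= 1.
Proof.
have distr := uniform_distribution R (0 : 'M[F]_(m, n)).
by rewrite (prob_ge0 distr) (prob_le1 distr).
Qed.

Lemma row_dependence_prob_le (m n : nat) :
  row_dependence_prob m n * #|F|%:R ^+ n <= #|F|%:R ^+ m.
Proof.
have F_gt0 : 0 < #|F|%:R :> R by rewrite ltr0n; apply/card_gt0P; exists 0.
rewrite -ler_pdivlMr ?exprn_gt0 //.
have -> : row_dependence_prob m n = prob uniform (fun M : 'M[F]_(m, n) =>
    [exists (u : 'rV[F]_m | u != 0), u *m M == 0]).
  apply: eq_mean => M; congr (nat_of_bool _)%:R.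
  apply/row_dependenceP/exists_inP => -[u u0 /eqP uM0].
    by exists u.
  by exists u => //; apply/eqP.
apply: le_trans (prob_exists_le (uniform_distribution R 0) _ _) _.
rewrite (eq_bigr (fun=> #|F|%:R ^- n)); last by move=> u; apply: prob_mulmx_eq0.
rewrite sumr_const -[leLHS]mulr_natl ler_wpM2r ?invr_ge0 ?exprn_ge0 ?ler0n //.
rewrite -natrX ler_nat (leq_trans (max_card _)) //.
by rewrite card_mx mul1n.
Qed.

End RandomMatrix.

Definition bernoulli_subset {R : pzRingType} {T : finType} (p : R) (A : {set T}) : R :=
  p ^+ #|A| * (1 - p) ^+ (#|T| - #|A|).

Lemma mean_bernoulliC (R : comPzRingType) (T : finType) (p : R) (f : {set T} -> R) :
  mean (bernoulli_subset (1 - p)) f = mean (bernoulli_subset p) (f \o @setC T).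
Proof.
rewrite /mean (reindex_inj (@setC_inj T)); apply: eq_bigr => A _; congr (_ * _).
by rewrite /bernoulli_subset -cardsCs subKr mulrC [#|~: A|]cardsCs setCK.
Qed.

Lemma mean_bernoulli_expr (R : comPzRingType) (T : finType) (p x : R) :
  mean (bernoulli_subset p) (fun A : {set T} => x ^+ #|A|)
  = (p * x + (1 - p)) ^+ #|T|.
Proof.
rewrite -prodr_const bigA_distr; apply: eq_bigr => A _.
rewrite big_if !prodr_const exprMn mulrAC; congr (_ * _ ^+ _).
rewrite [#|A|]cardsCs subKn ?max_card //.
by apply: eq_card => i; rewrite inE.
Qed.

Lemma bernoulli_subset_distribution (R : numDomainType) (T : finType) (p : R) :
  0 <= p <= 1 -> distribution (@bernoulli_subset R T p).
Proof.
case/andP=> p_ge0 p_le1; split=> [A|].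
  by rewrite mulr_ge0 ?exprn_ge0 ?subr_ge0.
have := mean_bernoulli_expr T p 1; rewrite mulr1 subrKC expr1n => <-.
by apply: eq_bigr => A _; rewrite expr1n mulr1.
Qed.

Lemma ler_expr_interpolate (R : numDomainType) (c x b : R) (m n : nat) :
  0 <= c <= 1 -> 1 <= x <= b -> c * b ^+ m <= b ^+ n -> c * x ^+ m <= x ^+ n.
Proof.
move=> /andP[c_ge0 c_le1] /andP[x_ge1 x_le_b].
have x_gt0 : 0 < x by apply: lt_le_trans x_ge1.
have b_gt0 : 0 < b by apply: lt_le_trans x_le_b.
have [m_le_n _|/ltnW n_le_m] := leqP m n.
  by rewrite (le_trans (ler_piMl _ c_le1)) ?exprn_ge0 ?ler_weXn2l // ltW.
rewrite -(subnK n_le_m) !exprD !mulrA !ger_pMl ?exprn_gt0 //.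
by apply: le_trans; rewrite ler_wpM2l // lerXn2r // nnegrE ltW.
Qed.

Lemma bernoulli_chernoff (R : numDomainType) (T : finType) (p b x : R)
    (f : {set T} -> R) (L : nat) :
  0 <= p <= 1 -> 1 <= x <= b -> (forall A, 0 <= f A <= 1) ->
  (forall A, f A * b ^+ L <= b ^+ #|A|) ->
  mean (bernoulli_subset p) f * x ^+ L <= (p * x + (1 - p)) ^+ #|T|.
Proof.
move=> p01 xb f01 fL; rewrite -mean_mulr -mean_bernoulli_expr.
apply: (ler_mean (bernoulli_subset_distribution T p01)) => A.
exact: ler_expr_interpolate (f01 A) xb (fL A).
Qed.

Lemma expr_AGM_le1 (R : numFieldType) (x y z : R) (m n : nat) :
  0 <= x -> 0 <= y -> 0 <= z -> x *+ m + y *+ n + z <= (m + n).+1%:R ->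
  x ^+ m * y ^+ n * z <= 1.
Proof.
move=> x_ge0 y_ge0 z_ge0 sum_le.
pose E (i : 'I_m + 'I_n + unit) :=
  match i with inl (inl _) => x | inl (inr _) => y | inr _ => z end.
have E_ge0 : {in predT, forall i, 0 <= E i} by case=> [[]|].
have := (leif_AGM E_ge0).1.
rewrite !big_sumType /= !sumr_const !prodr_const !card_sum card_unit !card_ord.
rewrite addn1 => /le_trans; apply; apply: exprn_ile1.
  by rewrite divr_ge0 // !addr_ge0 // mulrn_wge0.
by rewrite ler_pdivrMr ?ltr0Sn // mul1r.
Qed.

Definition tail_bound {R : unitRingType} (delta : R) (n : nat) : R :=
  (1 + n%:R * delta ^+ 2 / 8)^-1.

Lemma tail_bound_gt0 (R : realFieldType) (delta : R) (n : nat) :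
  0 < tail_bound delta n.
Proof. by rewrite invr_gt0 ltr_pwDl // divr_ge0 ?(mulr_ge0 _ (sqr_ge0 _)). Qed.

Lemma tail_bound_eventually_le (R : archiRealFieldType) (delta eps : R) :
  0 < delta -> 0 < eps ->
  exists N : nat, forall n : nat, (N <= n)%N -> tail_bound delta n <= eps.
Proof.
move=> delta_gt0 eps_gt0; pose N := Num.bound (8 / (eps * delta ^+ 2)).
have scale_gt0 : 0 < eps * delta ^+ 2 by rewrite mulr_gt0 ?exprn_gt0.
exists N => n N_le_n.
have : 8 / (eps * delta ^+ 2) <= n%:R.
  apply: le_trans (ltW (archi_boundP _)) _; last by rewrite ler_nat.
  by rewrite divr_ge0 // ltW.
have := tail_bound_gt0 delta n; rewrite invr_gt0 => bound_gt0.
rewrite ler_pdivrMr // => n_ge; rewrite -[tail_bound _ _]mul1r ler_pdivrMr //.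
lra.
Qed.

(* There is no exponential in R: instead of exp (- n delta^2 / 8), AM-GM gives the
   rational tail_bound, whose inverse is taken as one more factor; all n + L + 1
   factors together have mean at most 1. *)
Lemma chernoff_ratio_le (R : realFieldType) (p delta : R) (n L : nat) :
  0 <= p <= 1 -> 0 < delta <= 2 -> n%:R * (p + delta) <= L%:R ->
  (p * (1 + delta / 2) + (1 - p)) ^+ n <= tail_bound delta n * (1 + delta / 2) ^+ L.
Proof.
move=> /andP[p_ge0 p_le1] /andP[delta_gt0 delta_le2] le_L.
pose h := delta / 2; rewrite -/h.
have h_gt0 : 0 < h by rewrite /h; lra.
have x_gt0 : 0 < 1 + h by lra.
have hx_ge0 : 0 <= h / (1 + h) by rewrite ltW ?divr_gt0.
have bound_gt0 := tail_bound_gt0 delta n.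
rewrite -ler_pdivrMr ?exprn_gt0 // -[leRHS]mul1r -ler_pdivrMr // -exprVn invrK.
apply: expr_AGM_le1; rewrite ?invr_ge0 ?(ltW x_gt0) //.
- by rewrite addr_ge0 ?mulr_ge0 ?subr_ge0 // ltW.
- by rewrite -invr_ge0 ltW.
have gap_le : n%:R * (p * h + delta ^+ 2 / 8) <= L%:R * (h / (1 + h)).
  apply: le_trans (ler_wpM2r hx_ge0 le_L); rewrite -[leRHS]mulrA ler_wpM2l //.
  by rewrite [leRHS]mulrA ler_pdivlMr // /h; nra.
rewrite -[_ *+ n]mulr_natr -[_ *+ L]mulr_natr -[leRHS]natr1 natrD.
have -> : (1 + h)^-1 = 1 - h / (1 + h) by field; rewrite gt_eqF.
lra.
Qed.

Lemma mean_bernoulli_geometric_tail (R : realFieldType) (T : finType)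
    (p delta b : R) (f : {set T} -> R) (L : nat) :
  0 <= p <= 1 -> 0 < delta <= 2 -> 2 <= b ->
  #|T|%:R * (p + delta) <= L%:R ->
  (forall A, 0 <= f A <= 1) -> (forall A, f A * b ^+ L <= b ^+ #|A|) ->
  mean (bernoulli_subset p) f <= tail_bound delta #|T|.
Proof.
move=> p01 /[dup] delta02 /andP[delta_gt0 delta_le2] b_ge2 le_L f01 fL.
have x_b : 1 <= 1 + delta / 2 <= b by lra.
have xL_gt0 : 0 < (1 + delta / 2) ^+ L by rewrite exprn_gt0 //; lra.
rewrite -(ler_pM2r xL_gt0); apply: le_trans (chernoff_ratio_le p01 delta02 le_L).
exact: bernoulli_chernoff p01 x_b f01 fL.
Qed.

Section RandomShape.
Variables (R : realFieldType) (F : finFieldType) (T : finType) (p delta : R).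
Hypotheses (p01 : 0 <= p <= 1) (delta02 : 0 < delta <= 2).

Let card_field_ge2 : 2 <= #|F|%:R :> R.
Proof. by rewrite ler_nat card_finNzRing_gt1. Qed.

Lemma mean_row_dependence_random_height_le (n : nat) :
  #|T|%:R * (p + delta) <= n%:R ->
  mean (bernoulli_subset p) (fun A : {set T} => row_dependence_prob R F #|A| n)
  <= tail_bound delta #|T|.
Proof.
move=> le_n; apply: (mean_bernoulli_geometric_tail p01 delta02 card_field_ge2 le_n).
  by move=> A; apply: row_dependence_prob01.
by move=> A; apply: row_dependence_prob_le.
Qed.

Lemma mean_row_dependence_random_width_le (m : nat) :
  m%:R <= #|T|%:R * (p - delta) ->
  mean (bernoulli_subset p) (fun A : {set T} => row_dependence_prob R F m #|A|)
  <= tail_bound delta #|T|.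
Proof.
move=> le_m; have [[p_ge0 p_le1] [delta_gt0 _]] := (andP p01, andP delta02).
have q01 : 0 <= 1 - p <= 1 by lra.
have m_le_T : (m <= #|T|)%N.
  by rewrite -(ler_nat R) (le_trans le_m) // ler_piMr //; lra.
have le_L : #|T|%:R * (1 - p + delta) <= (#|T| - m)%:R by rewrite natrB //; lra.
rewrite -[p](subKr 1) mean_bernoulliC.
apply: (mean_bernoulli_geometric_tail q01 delta02 card_field_ge2 le_L) => A /=.
  exact: row_dependence_prob01.
have q_gt0 : 0 < #|F|%:R :> R by rewrite (lt_le_trans _ card_field_ge2).
rewrite -(ler_pM2r (exprn_gt0 #|~: A| q_gt0)) mulrAC -exprD cardsC.
rewrite -[X in _ <= _ ^+ X](subnKC m_le_T) exprD ler_pM2r ?exprn_gt0 //.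
exact: row_dependence_prob_le.
Qed.

End RandomShape.

Definition row_restrict {R : Type} {n p : nat} (A : {set 'I_n}) (M : 'M[R]_(n, p)) :
  'M[R]_(#|A|, p) := rowsub (@enum_val _ [in A]) M.

Lemma row_restrict_eqP (R : eqType) (n : nat) (A : {set 'I_n}) (u v : 'cV[R]_n) :
  reflect (row_restrict A u = row_restrict A v) [forall i in A, u i 0 == v i 0].
Proof.
apply: (iffP forall_inP) => [eq_uv | /matrixP eq_uv i iA].
  by apply/matrixP => a j; rewrite !mxE ord1; apply/eqP/eq_uv/enum_valP.
by have := eq_uv (enum_rank_in iA i) 0; rewrite !mxE enum_rankK_in // => ->.
Qed.

HB.instance Definition _ (R : pzRingType) n p (A : {set 'I_n}) :=
  GRing.Linear.copy (@row_restrict R n p A) (rowsub (@enum_val _ [in A])).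

Lemma mul_row_restrict_mx (R : pzRingType) n p q (A : {set 'I_n})
    (M : 'M[R]_(n, p)) (N : 'M_(p, q)) :
  row_restrict A M *m N = row_restrict A (M *m N).
Proof. exact: mul_rowsub_mx. Qed.

Lemma row_restrictK (R : pzRingType) n p (A : {set 'I_n}) :
  cancel (mulmx (row_restrict A 1%:M)^T) (@row_restrict R n p A).
Proof.
move=> N; rewrite -mul_row_restrict_mx.
have -> : row_restrict A (row_restrict A 1%:M)^T = 1%:M :> 'M[R]_#|A|.
  by apply/matrixP=> i j; rewrite !mxE (inj_eq enum_val_inj) eq_sym.
exact: mul1mx.
Qed.

Lemma encode_d_None n k l (G : 'M['F_2]_(n, k + l)) U s m :
  encode_d G U s m = None -> ~~ row_free (row_restrict U (rsubmx G)).
Proof.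
rewrite /encode_d; case: pickP => // no_sol _.
apply/negP=> /row_freeP[B GB1].
have /row_restrict_eqP[] := negbT (no_sol (B *m row_restrict U (lsubmx G *m m + s))).
by rewrite -mul_row_restrict_mx mulmxA GB1 mul1mx.
Qed.

Lemma encode_d_Some n k l (G : 'M['F_2]_(n, k + l)) U s m d :
  encode_d G U s m = Some d -> {in U, forall i, (G *m col_mx m d) i 0 = s i 0}.
Proof.
rewrite /encode_d; case: pickP => // d' /forall_inP d'P [<-] i iU.
rewrite -{1}[G]hsubmxK mul_row_col mxE (eqP (d'P i iU)) [X in _ + X]mxE addrA.
by rewrite -mulr2n -mulr_natl pchar_Fp_0 // mul0r add0r.
Qed.

Lemma recovery_failure_row_dependent n k l (G : 'M['F_2]_(n, k + l)) U s V m :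
  recovery_failure G U s V m ->
  ~~ row_free (row_restrict U (rsubmx G)) || ~~ row_free (row_restrict V G)^T.
Proof.
rewrite /recovery_failure; case enc: (encode_d G U s m) => [d|]; last first.
  by rewrite (encode_d_None enc).
case/orP=> [/existsP[x1 /existsP[x2 /and3P[sol1 sol2 neq]]]|/negP[]]; last first.
  apply/forall_inP=> i _; rewrite mxE; case: ifP => [iU|_].
    by rewrite (encode_d_Some enc iU).
  by rewrite -{1}[G]hsubmxK mul_row_col.
apply/orP; right; apply: contraNN neq => /row_free_inj free_inj.
have Gx12 : row_restrict V G *m x1 = row_restrict V G *m x2.
  rewrite !mul_row_restrict_mx.
  by rewrite (row_restrict_eqP _ _ _ sol1) (row_restrict_eqP _ _ _ sol2).
apply/eqP; congr usubmx; apply/trmx_inj/free_inj.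
by rewrite -!trmx_mul Gx12.
Qed.

Lemma fail_probE (R : numFieldType) (alpha beta : R) n k l m :
  fail_prob alpha beta n k l m =
  mean uniform (fun G : 'M['F_2]_(n, k + l) =>
  mean (bernoulli_subset beta) (fun U : {set 'I_n} =>
  mean uniform (fun s : 'cV['F_2]_n =>
  mean (bernoulli_subset (1 - alpha)) (fun V : {set 'I_n} =>
    (recovery_failure G U s V m)%:R)))).
Proof.
rewrite /mean; apply: eq_bigr => G _.
rewrite !mulr_sumr; apply: eq_bigr => U _.
rewrite !mulr_sumr; apply: eq_bigr => s _.
rewrite !mulr_sumr; apply: eq_bigr => V _.
rewrite /uniform /bernoulli_subset !card_mx card_Fp // muln1 card_ord subKr.
by rewrite !natrX !exprVn !mulrA.
Qed.

Lemma prob_row_restrict_rsubmx_dependent (R : numFieldType) (F : finFieldType)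
    n k l (U : {set 'I_n}) :
  prob uniform (fun G : 'M[F]_(n, k + l) =>
    ~~ row_free (row_restrict U (rsubmx G))) = row_dependence_prob R F #|U| l.
Proof.
have restrictK : cancel (row_mx 0 \o mulmx (row_restrict U 1%:M)^T)
    (row_restrict U \o @rsubmx F n k l).
  by move=> N; rewrite /= row_mxKr row_restrictK.
exact: (mean_uniform_additive (fun M => (~~ row_free M)%:R) restrictK).
Qed.

Lemma prob_tr_row_restrict_dependent (R : numFieldType) (F : finFieldType)
    n k (V : {set 'I_n}) :
  prob uniform (fun G : 'M[F]_(n, k) => ~~ row_free (row_restrict V G)^T)
  = row_dependence_prob R F k #|V|.
Proof.
have restrictK : cancel (mulmx (row_restrict V 1%:M)^T \o trmx)
    (trmx \o @row_restrict F n k V).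
  by move=> N; rewrite /= row_restrictK trmxK.
exact: (mean_uniform_additive (fun M => (~~ row_free M)%:R) restrictK).
Qed.

Lemma fail_prob_le_mean (R : numFieldType) (alpha beta : R) n k l m :
  0 <= alpha <= 1 -> 0 <= beta <= 1 ->
  fail_prob alpha beta n k l m <=
    mean (bernoulli_subset beta)
      (fun U : {set 'I_n} => row_dependence_prob R 'F_2 #|U| l)
  + mean (bernoulli_subset (1 - alpha))
      (fun V : {set 'I_n} => row_dependence_prob R 'F_2 (k + l) #|V|).
Proof.
move=> alpha01 beta01.
have alphaC01 : 0 <= 1 - alpha <= 1 by rewrite subr_ge0 gerBl andbC.
have distrV := bernoulli_subset_distribution 'I_n alphaC01.
have distrU := bernoulli_subset_distribution 'I_n beta01.
have distrG := uniform_distribution R (0 : 'M['F_2]_(n, k + l)).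
have distrS := uniform_distribution R (0 : 'cV['F_2]_n).
under [X in X + _]eq_mean do rewrite -(prob_row_restrict_rsubmx_dependent R 'F_2 k).
under [X in _ + X]eq_mean do rewrite -prob_tr_row_restrict_dependent.
rewrite fail_probE /prob !(exchange_mean (bernoulli_subset _)) -meanD.
apply: (ler_mean distrG) => G.
rewrite -[X in _ <= _ + X](mean_cst distrU) -meanD; apply: (ler_mean distrU) => U.
rewrite -[leRHS](mean_cst distrS); apply: (ler_mean distrS) => s.
rewrite -[X in _ <= X + _](mean_cst distrV) -meanD; apply: (ler_mean distrV) => V.
rewrite -natrD ler_nat.
have [/recovery_failure_row_dependent|//] := boolP (recovery_failure _ _ _ _ _).
by do 2!case: (row_free _).
Qed.

Lemma fail_prob_le (R : realFieldType) (alpha beta delta : R) n k l m :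
  0 <= alpha <= 1 -> 0 <= beta <= 1 -> 0 < delta ->
  beta + delta <= l%:R / n%:R -> (k + l)%:R / n%:R <= 1 - alpha - delta ->
  fail_prob alpha beta n k l m <= tail_bound delta n *+ 2.
Proof.
move=> alpha01 beta01 delta_gt0 le_l le_kl.
have [[alpha_ge0 _] [beta_ge0 _]] := (andP alpha01, andP beta01).
have n_gt0 : 0 < n%:R :> R.
  rewrite lt0r ler0n andbT; apply/eqP=> n_eq0.
  by move: le_l; rewrite n_eq0 invr0 mulr0; lra.
have delta02 : 0 < delta <= 2.
  by have := divr_ge0 (ler0n R (k + l)) (ltW n_gt0); lra.
have alphaC01 : 0 <= 1 - alpha <= 1 by lra.
move: le_l le_kl; rewrite ler_pdivlMr // ler_pdivrMr // => le_l le_kl.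
apply: le_trans (fail_prob_le_mean _ _ _ alpha01 beta01) _.
rewrite mulr2n -[n in leRHS](card_ord n); apply: lerD.
  by apply: mean_row_dependence_random_height_le; rewrite // card_ord mulrC.
by apply: mean_row_dependence_random_width_le; rewrite // card_ord mulrC.
Qed.

Theorem theorem3 (R : archiRealFieldType) (alpha beta : R) (k l : nat -> nat)
  (m : forall n : nat, 'cV['F_2]_(k n)) :
  0 <= alpha < 1 -> 0 <= beta < 1 -> alpha + beta < 1 ->
  (exists2 delta : R, 0 < delta &
     exists N : nat, forall n : nat, (N <= n)%N -> beta + delta <= (l n)%:R / n%:R) ->
  (exists2 delta : R, 0 < delta &
     exists N : nat, forall n : nat, (N <= n)%N ->
       (k n + l n)%:R / n%:R <= 1 - alpha - delta) ->
  forall eps : R, 0 < eps ->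
    exists N : nat, forall n : nat, (N <= n)%N ->
      fail_prob alpha beta n (k n) (l n) (m n) <= eps.
Proof.
move=> /andP[alpha_ge0 /ltW alpha_le1] /andP[beta_ge0 /ltW beta_le1] _.
move=> [d0 d0_gt0 [N0 le_l]] [d1 d1_gt0 [N1 le_kl]] eps eps_gt0.
pose delta := Num.min d0 d1.
have delta_gt0 : 0 < delta by rewrite lt_min d0_gt0.
have half_eps_gt0 : 0 < eps / 2 by rewrite divr_gt0.
have [N2 bound_le] := tail_bound_eventually_le delta_gt0 half_eps_gt0.
exists (maxn (maxn N0 N1) N2) => n; rewrite !geq_max => /andP[/andP[N0n N1n] N2n].
apply: (@le_trans _ _ (tail_bound delta n *+ 2)); last first.
  by rewrite -mulr_natr -ler_pdivlMr // bound_le.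
apply: fail_prob_le; rewrite ?alpha_ge0 ?beta_ge0 //.
- by apply: le_trans (le_l n N0n); rewrite lerD2l ge_min lexx.
- by apply: le_trans (le_kl n N1n) _; rewrite lerD2l lerN2 ge_min lexx orbT.
Qed.
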